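(* Let $n\ge 0$ be an integer with $n\not\equiv 1\bmod 3$. Define a diagonal array as follows. Let $u_0=4n+1$ and $u_i=2u_{i-1}+1$ for $i\ge 1$. For $j\ge 0$ let $v_{0,j}=u_j$, and for $k\ge 1$ let $v_{k,k}=3v_{k-1,k-1}+2$. Finally, for $j>i$, let $v_{i,j}=2v_{i,j-1}+1$. (So $v_{i,j}$ is defined for $0\le i\le j$, with $i$ the row index and $j$ the column index.) This array has the following properties. 1. $u_k\not\equiv 2\bmod 3$ for all $k\ge 0$, whereas $v_{i,j}\equiv 2\bmod 3$ if $i>0$ and $j>0$. 2. $u_0\equiv 1\bmod 4$ and $v_{i,i}\equiv 1\bmod 4$ for all $i$; $u_i\not\equiv 1\bmod 4$ for $i>0$, and $v_{i,j}\not\equiv 1\bmod 4$ if $i\ne j$. 3. For $i\ge 0$, if $u_i\equiv 1\bmod 3$ then $u_{i+1}\equiv 0\bmod 3$. On the other hand, if $u_i\equiv 0\bmod 3$ then $u_{i+1}\equiv 1\bmod 3$. 4. If $u_0\equiv 0\bmod 3$, write $u_0=3N$ for some $N$, and for $i\ge 0$ let $j_i$ denote the jump of height $i$ from $N$; then $u_{2i}=3j_i$ and $u_{2i+1}=6j_i+1$. Alternately, if $u_1\equiv 0\bmod 3$, write $u_1=3N$ for some $N$, and for $i\ge 0$ let $j_i$ denote the jump of height $i$ from $N$; then $u_{2i+1}=3j_i$ and $u_{2i+2}=6j_i+1$. 5. For $j\ge 1$, the $j$-th column $v_{0,j},v_{1,j},\dots,v_{j,j}$ is the first few (that is, the first $j+1$)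 odd numbers in the Collatz sequence of $u_j$. 6. For $j\ge i>0$, $v_{i,j}=3v_{i-1,j-1}+2$. 7. Let $a_{i,i}$ denote the odd number that comes after $v_{i,i}$ in the Collatz sequence of $v_{i,i}$. If $n$ is even, then for $k\ge 0$, $a_{2k,2k}\equiv 1\bmod 3$ and $v_{2k+1,2k+1}=4a_{2k,2k}+1$; moreover, $a_{2k,2k}$ is smaller than both $v_{2k,2k}$ and $v_{2k+1,2k+1}$. If $n$ is odd, then for $k\ge 1$, $a_{2k-1,2k-1}\equiv 1\bmod 3$ and $v_{2k,2k}=4a_{2k-1,2k-1}+1$; moreover, $a_{2k-1,2k-1}$ is smaller than both $v_{2k-1,2k-1}$ and $v_{2k,2k}$. 8. If $n$ is odd, then for $k\ge 1$ the Collatz sequences of $u_{2k-1}$ and $u_{2k}$ merge. If $n$ is even, then for $k\ge 0$ the Collatz sequences of $u_{2k}$ and $u_{2k+1}$ merge. 9. For every $n>0$ such that $n\not\equiv 1\bmod 3$, the Collatz sequence of $u_0$ merges with the Collatz sequence of a smaller number $a$ such that $a\not\equiv 2\bmod 3$.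
   Context: The Collatz sequence of a positive integer $A$ is $c_0=A$, and for $i\ge1$, $c_i=3c_{i-1}+1$ if $c_{i-1}$ is odd and $c_i=c_{i-1}/2$ if $c_{i-1}$ is even. The odd number that comes after an odd term is the next odd term of the sequence (the odd term $1$ is followed by $1$). Two Collatz sequences merge if they become equal after a finite number of terms of each, i.e. sequences $(c_i)$ and $(c'_i)$ merge if there are $s,t\ge 0$ with $c_{s+i}=c'_{t+i}$ for all $i\ge 0$. The jump of height $d\ge 1$ from $N$ is $4^dN+4^{d-1}+\cdots+4+1$; the jump of height $0$ from $N$ is $N$ itself. Thus $j_0=N$ and $j_{i+1}=4j_i+1$.
   Formalization: In part 7, the claim that a_{2k,2k} is smaller than v_{2k,2k} is not asserted for n = k = 0, where it fails: v_{0,0} = 1 and, since 1 is followed by 1, a_{0,0} = 1. *)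

(* Defs.v *)
From mathcomp Require Import all_boot.

Set Implicit Arguments.
Unset Strict Implicit.
Unset Printing Implicit Defensive.

Definition collatz_step (c : nat) : nat := if odd c then 3 * c + 1 else c./2.

Definition collatz (A i : nat) : nat := iter i collatz_step A.

Definition collatz_merge (A B : nat) : Prop :=
  exists s t, forall i, collatz A (s + i) = collatz B (t + i).

(* The position t is the first one after 0 carrying an odd term, so for odd x
   this relation determines a; in particular 1 is followed by 1. *)
Definition next_odd_term (x a : nat) : Prop :=
  exists t, [/\ 0 < t, collatz x t = a, odd a
              & forall s, 0 < s < t -> ~~ odd (collatz x s)].

(* The odd terms among some initial segment c_0, ..., c_(N-1), listed in order
   and with repetitions, are exactly w. *)
Definition first_odd_terms (A : nat) (w : seq nat) : Prop :=
  exists N, [seq c <- mkseq (collatz A) N | odd c] = w.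

Definition jump (d N : nat) : nat := 4 ^ d * N + \sum_(k < d) 4 ^ k.

Definition u (n i : nat) : nat := iter i (fun x => 2 * x + 1) (4 * n + 1).

(* Row i, column j. Only the entries with i <= j are meaningful: below the
   diagonal the truncated j - i makes v n i j repeat v n i i. *)
Fixpoint v (n i j : nat) : nat :=
  if i is i'.+1
  then iter (j - i) (fun x => 2 * x + 1) (3 * v n i' i' + 2)
  else u n j.

(* Main.v *)
(* Everything rests on the closed form v_{i,j} + 1 = 2^(j-i+1) 3^i (2n+1). It
   gives the congruences, and an entry v off the diagonal is 3 mod 4, so that
   its next odd term is (3v+1)/2, the entry below it: u_j climbs down column j
   to the diagonal. In the cases of part 7, 3^(i+1) (2n+1) is 3 mod 4, so
   3 v_{i,i} + 1 = 4a with a odd and v_{i+1,i+1} = 4a + 1. Since a and 4a + 1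
   both reach 3a + 1, the columns i and i+1 merge. *)

Require Import Defs.
From mathcomp Require Import all_boot zify.

Set Implicit Arguments.
Unset Strict Implicit.
Unset Printing Implicit Defensive.

Lemma iter_double_succ j x : (iter j (fun y => 2 * y + 1) x).+1 = 2 ^ j * x.+1.
Proof. by elim: j => [|j IHj] /=; rewrite ?expn0 ?mul1n // expnS; nia. Qed.

Lemma succ_u n j : (u n j).+1 = 2 ^ j.+1 * (2 * n + 1).
Proof. by rewrite /u iter_double_succ expnS; nia. Qed.

Lemma u0 n : u n 0 = 4 * n + 1.
Proof. by []. Qed.

Lemma uS n j : u n j.+1 = 2 * u n j + 1.
Proof. by []. Qed.

Lemma succ_v_diag n i : (v n i i).+1 = 2 * 3 ^ i * (2 * n + 1).
Proof.
elim: i => [|i IHi]; first exact: (succ_u n 0).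
by rewrite /= subnn /= expnS; nia.
Qed.

Lemma succ_v n i j :
  i <= j -> (v n i j).+1 = 2 ^ (j - i).+1 * 3 ^ i * (2 * n + 1).
Proof.
case: i => [|i] leij; first by rewrite subn0 muln1; exact: succ_u.
rewrite [v _ _ _]/= iter_double_succ.
have := succ_v_diag n i; rewrite !expnS; nia.
Qed.

Lemma v_below n i j : i < j -> 2 * v n i.+1 j = 3 * v n i j + 1.
Proof.
move=> ltij; have := succ_v n ltij; have := succ_v n (ltnW ltij).
rewrite subnSK // expnS (expnS 3); nia.
Qed.

Lemma v_next_diag n i j : i <= j -> v n i.+1 j.+1 = 3 * v n i j + 2.
Proof.
move=> leij; have := succ_v n leij; have := @succ_v n i.+1 j.+1 leij.
rewrite subSS (expnS 3); nia.
Qed.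

(** The exponent of 2 in the closed form of [v n i j + 1] is at least 2 off the diagonal and exactly
    1 on it. *)
Lemma v_mod4_offdiag n i j : i < j -> v n i j = 3 %[mod 4].
Proof.
move=> ltij; have := succ_v n (ltnW ltij).
by rewrite -subnSK // !expnS; lia.
Qed.

Lemma v_diag_mod4 n i : v n i i = 1 %[mod 4].
Proof.
have : odd (3 ^ i * (2 * n + 1)) by rewrite oddM oddX /=; lia.
by have := succ_v_diag n i; lia.
Qed.

Lemma odd_v n i j : i <= j -> odd (v n i j).
Proof.
rewrite leq_eqVlt => /predU1P[<-|/(v_mod4_offdiag n)]; last by lia.
by have := v_diag_mod4 n i; lia.
Qed.

Lemma v_mod3 n i j : 0 < i -> i <= j -> v n i j = 2 %[mod 3].
Proof.
by case: i => // i _ /(succ_v n); rewrite (expnS 3); lia.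
Qed.

(** Modulo 3 the map x -> 2x + 1 fixes 2 and swaps 0 and 1, and 4n + 1 is 2 only when n is 1. *)
Lemma u_mod3 n k : n <> 1 %[mod 3] -> u n k <> 2 %[mod 3].
Proof.
move=> hn; elim: k => [|k IHk]; first by rewrite u0; lia.
by rewrite uS; lia.
Qed.

Lemma jump0 N : jump 0 N = N.
Proof. by rewrite /jump big_ord0; lia. Qed.

Lemma jumpS d N : jump d.+1 N = 4 * jump d N + 1.
Proof.
rewrite /jump big_ord_recl expnS.
under eq_bigr do rewrite expnS.
by rewrite -big_distrr /=; lia.
Qed.

(** Two steps of x -> 2x + 1 give 4x + 3, which sends 3j to 3(4j + 1). The offsets r = 0 and r = 1
    are the two cases of part 4. *)
Lemma u_jump n r N i : u n r = 3 * N ->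
  u n (2 * i + r) = 3 * jump i N /\ u n (2 * i + r.+1) = 6 * jump i N + 1.
Proof.
move=> uN; suff ui : u n (2 * i + r) = 3 * jump i N.
  by rewrite addnS uS ui; lia.
elim: i => [|i IHi]; first by rewrite jump0.
have -> : 2 * i.+1 + r = (2 * i + r).+2 by lia.
by rewrite !uS jumpS; lia.
Qed.

Lemma collatzD A s t : collatz A (s + t) = collatz (collatz A s) t.
Proof. by rewrite /collatz addnC iterD. Qed.

Lemma collatz1_odd x : odd x -> collatz x 1 = 3 * x + 1.
Proof. by rewrite /collatz /= /collatz_step => ->. Qed.

Lemma collatz_pow2 t y : collatz (2 ^ t * y) t = y.
Proof.
elim: t => [|t IHt]; first by rewrite mul1n.
rewrite -[t.+1]add1n collatzD {1}/collatz /= /collatz_step.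
rewrite expnD -mulnA oddM /= mul2n doubleK; exact: IHt.
Qed.

Lemma collatz_odd_pow2 x t y :
  odd x -> 3 * x + 1 = 2 ^ t * y -> collatz x t.+1 = y.
Proof. by move=> ox e; rewrite -[t.+1]add1n collatzD collatz1_odd // e collatz_pow2. Qed.

Lemma next_odd_termP x t a :
  odd x -> odd a -> 3 * x + 1 = 2 ^ t * a -> next_odd_term x a.
Proof.
move=> ox oa e; exists t.+1; split=> //; first exact: collatz_odd_pow2.
case=> // s /andP[_]; rewrite ltnS => ltst.
(* The term at position s + 1 is 2^(t-s) a with t - s > 0, hence even. *)
rewrite (@collatz_odd_pow2 _ s (2 ^ (t - s) * a)) //.
  by rewrite oddM oddX subn_eq0 leqNgt ltst.
by rewrite mulnA -expnD subnKC // ltnW.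
Qed.

(** The odd part of 3x + 1 is a formula valid for every odd x, so a single function can serve the
    whole diagonal in part 7. *)
Lemma next_odd_term_odd_part x : odd x -> next_odd_term x ((3 * x + 1)`_2^').
Proof.
move=> ox; apply: (@next_odd_termP _ (logn 2 (3 * x + 1))) => //.
  by rewrite odd_2'nat part_pnat.
by rewrite -p_part partnC // addn1.
Qed.

Lemma odd_part_mul4 b : odd b -> (4 * b)`_2^' = b.
Proof.
move=> ob; have b0 : 0 < b by case: b ob.
rewrite partnM // (@part_p'nat _ 4) ?mul1n; last by rewrite pnatNK.
by rewrite part_pnat_id // -odd_2'nat.
Qed.

Lemma collatz_merge_at A B s t :
  collatz A s = collatz B t -> collatz_merge A B.
Proof. by move=> e; exists s, t => i; rewrite !collatzD e. Qed.

Lemma collatz_u n i j : i <= j -> collatz (u n j) (2 * i) = v n i j.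
Proof.
elim: i => [//|i IHi] ltij.
rewrite mulnS addnC collatzD IHi 1?ltnW //.
by apply: (@collatz_odd_pow2 _ 1); [exact/odd_v/ltnW | rewrite v_below].
Qed.

(** Positions 2i and 2i + 2 carry consecutive column entries, and position 2i + 1 carries the even
    number 3v + 1, which the filter drops. *)
Lemma odd_terms_u n i j : i <= j ->
  [seq c <- mkseq (collatz (u n j)) (2 * i).+1 | odd c]
    = mkseq (fun k => v n k j) i.+1.
Proof.
elim: i => [|i IHi] leij.
  by rewrite /mkseq /= (odd_v n leij : odd (u n j)).
have oi := odd_v n (ltnW leij).
rewrite (mkseqS (fun k => v n k j)) -IHi ?(ltnW leij) //.
have -> : (2 * i.+1).+1 = (2 * i).+3 by lia.
rewrite (mkseqS _ (2 * i).+2) (mkseqS _ (2 * i).+1) !filter_rcons.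
have -> : (2 * i).+2 = 2 * i.+1 by lia.
rewrite collatz_u // odd_v // -[(2 * i).+1]addn1 collatzD collatz_u ?(ltnW leij) //.
by rewrite collatz1_odd // oddD oddM oi.
Qed.

Lemma v_diag_quadruple n i : odd n = odd i -> exists b,
  [/\ odd b, 3 * v n i i + 1 = 4 * b, v n i.+1 i.+1 = 4 * b + 1 & b = 1 %[mod 3]].
Proof.
move=> parity.
have h3 : 3 ^ i = (if odd i then 3 else 1) %[mod 4].
  by elim: (i) => [//|k IHk]; rewrite expnS /=; case: (odd k) IHk => /=; lia.
have succ_vi := succ_v_diag n i.
have h8 : v n i i = 1 %[mod 8].
  (* Equal parities make 3^i (2n+1) congruent to 1 mod 4, so its double is 2 mod 8. Explicit
     quotients turn this into polynomial arithmetic. *)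
  have [q [r [eq er]]]: exists q r,
      (3 ^ i = 4 * q + (if odd i then 3 else 1)) /\ (n = 2 * r + odd i).
    exists (3 ^ i %/ 4), (n %/ 2); case: (odd i) h3 parity => /=; lia.
  by move: succ_vi; rewrite eq er; case: (odd i) => /=; nia.
by exists ((3 * v n i i + 1) %/ 4); rewrite v_next_diag //; split; lia.
Qed.

Lemma collatz_merge_u n i :
  odd n = odd i -> collatz_merge (u n i) (u n i.+1).
Proof.
move=> /v_diag_quadruple[b [ob eb eb' _]].
(* The common term is 3b + 1. From v_{i,i}, three steps reach b and one more reaches 3b + 1; from
   v_{i+1,i+1} = 4b + 1, three steps suffice, as 3(4b+1) + 1 = 4(3b+1). *)
apply: (@collatz_merge_at _ _ (2 * i + 3 + 1) (2 * i.+1 + 3)).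
rewrite (collatzD _ (2 * i + 3)) (collatzD _ (2 * i)) (collatzD _ (2 * i.+1)).
rewrite !collatz_u // (collatz_odd_pow2 (t := 2) _ eb) ?odd_v //.
rewrite collatz1_odd // (@collatz_odd_pow2 _ 2 (3 * b + 1)) ?odd_v //.
by rewrite eb'; lia.
Qed.

Lemma next_odd_diag n i (a := (3 * v n i i + 1)`_2^') : odd n = odd i ->
  [/\ a = 1 %[mod 3], v n i.+1 i.+1 = 4 * a + 1,
      1 < v n i i -> a < v n i i & a < v n i.+1 i.+1].
Proof.
move=> /v_diag_quadruple[b [ob eb eb' b3]].
have -> : a = b by rewrite /a eb odd_part_mul4.
(* From 4b = 3v + 1, b < v amounts to v > 1; the value v = 1 is its own next odd term. *)
by split=> //; lia.
Qed.

Lemma v_diag_gt1 n i : (0 < n) || (0 < i) -> 1 < v n i i.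
Proof.
move=> ni; have := succ_v_diag n i; case: i ni => [|i] ni; first by rewrite /=; lia.
by rewrite expnS; have := expn_gt0 3 i; nia.
Qed.

Theorem theorem5p1 (n : nat) (hn : n <> 1 %[mod 3]) :
  (* 1 *)
  ((forall k, u n k <> 2 %[mod 3]) /\
   (forall i j, 0 < i -> 0 < j -> i <= j -> v n i j = 2 %[mod 3])) /\
  (* 2 *)
  [/\ u n 0 = 1 %[mod 4],
      forall i, v n i i = 1 %[mod 4],
      forall i, 0 < i -> u n i <> 1 %[mod 4]
    & forall i j, i <= j -> i <> j -> v n i j <> 1 %[mod 4]] /\
  (* 3 *)
  (forall i, (u n i = 1 %[mod 3] -> u n i.+1 = 0 %[mod 3]) /\
             (u n i = 0 %[mod 3] -> u n i.+1 = 1 %[mod 3])) /\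
  (* 4 *)
  ((u n 0 = 0 %[mod 3] ->
      exists N, u n 0 = 3 * N /\
        forall i, u n (2 * i) = 3 * jump i N /\
                  u n (2 * i + 1) = 6 * jump i N + 1) /\
   (u n 1 = 0 %[mod 3] ->
      exists N, u n 1 = 3 * N /\
        forall i, u n (2 * i + 1) = 3 * jump i N /\
                  u n (2 * i + 2) = 6 * jump i N + 1)) /\
  (* 5 *)
  (forall j, 1 <= j -> first_odd_terms (u n j) (mkseq (fun i => v n i j) j.+1)) /\
  (* 6 *)
  (forall i j, 0 < i -> i <= j -> v n i j = 3 * v n (i - 1) (j - 1) + 2) /\
  (* 7; for n = k = 0 one has a 0 = v n 0 0 = 1, so the strict comparison of
     these two numbers excludes that single case *)
  (exists a : nat -> nat,
     (forall i, next_odd_term (v n i i) (a i)) /\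
     (~~ odd n -> forall k,
        [/\ a (2 * k) = 1 %[mod 3],
            v n (2 * k + 1) (2 * k + 1) = 4 * a (2 * k) + 1,
            ~ (n = 0 /\ k = 0) -> a (2 * k) < v n (2 * k) (2 * k)
          & a (2 * k) < v n (2 * k + 1) (2 * k + 1)]) /\
     (odd n -> forall k, 1 <= k ->
        [/\ a (2 * k - 1) = 1 %[mod 3],
            v n (2 * k) (2 * k) = 4 * a (2 * k - 1) + 1,
            a (2 * k - 1) < v n (2 * k - 1) (2 * k - 1)
          & a (2 * k - 1) < v n (2 * k) (2 * k)])) /\
  (* 8 *)
  ((odd n -> forall k, 1 <= k -> collatz_merge (u n (2 * k - 1)) (u n (2 * k))) /\
   (~~ odd n -> forall k, collatz_merge (u n (2 * k)) (u n (2 * k + 1)))) /\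
  (* 9 *)
  (0 < n -> exists a, [/\ 0 < a, a < u n 0, a <> 2 %[mod 3] & collatz_merge (u n 0) a]).
Proof.
split; first by split=> [k|i j i0 _ leij]; [exact: u_mod3 | exact: v_mod3].
split.
  split=> [|i|i i0|i j leij /eqP neij].
  - by rewrite u0; lia.
  - exact: v_diag_mod4.
  - by have : u n i = 3 %[mod 4] := v_mod4_offdiag n i0; lia.
  - have ltij : i < j by rewrite ltn_neqAle neij.
    by have := v_mod4_offdiag n ltij; lia.
split; first by move=> i; rewrite uS; lia.
split.
  split=> ur.
    exists (u n 0 %/ 3); have uN : u n 0 = 3 * (u n 0 %/ 3) by lia.
    by split=> // i; have := u_jump i uN; rewrite addn0.
  exists (u n 1 %/ 3); have uN : u n 1 = 3 * (u n 1 %/ 3) by lia.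
  by split=> // i; exact: u_jump.
split; first by move=> j _; exists (2 * j).+1; exact: odd_terms_u.
split.
  by case=> // i [//|j] _ leij; rewrite !subn1 v_next_diag.
split.
  exists (fun i => (3 * v n i i + 1)`_2^'); split.
    by move=> i; apply/next_odd_term_odd_part/odd_v.
  split=> on k.
    have par : odd n = odd (2 * k) by rewrite oddM (negbTE on).
    have [h1 h2 h3 h4] := next_odd_diag par; rewrite (addn1 (2 * k)); split=> // nk0.
    by apply/h3/v_diag_gt1; lia.
  move=> k0; have par : odd n = odd (2 * k - 1) by lia.
  have ek : (2 * k - 1).+1 = 2 * k by lia.
  have [h1 h2 h3 h4] := next_odd_diag par; rewrite ek in h2 h4; split=> //.
  by apply/h3/v_diag_gt1; lia.
split.
  split=> on k => [k0|]; last first.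
    by rewrite addn1; apply: collatz_merge_u; rewrite oddM (negbTE on).
  have {2}-> : 2 * k = (2 * k - 1).+1 by lia.
  by apply: collatz_merge_u; lia.
(* Since 3(4n+1) + 1 = 4(3n+1), the sequence of [u n 0] reaches 3n + 1 after three steps, whatever
   the parity of 3n + 1. *)
move=> n0; exists (3 * n + 1); split; rewrite ?u0; try lia.
apply: (@collatz_merge_at _ _ 3 0).
by rewrite (@collatz_odd_pow2 _ 2 (3 * n + 1)) //; lia.
Qed.
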